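(* For every $A\in(0,\infty]$ (that is, $A$ an arbitrary positive real number or $A=\infty$) there exists a smooth function $u:\mathbb{R}^2\to\mathbb{R}$ satisfying $\Delta u+e^{2u}\le 0$ on $\mathbb{R}^2$ such that the conformal plane $X^u$ has area equal to $A$.
   Context: For a smooth function $u:\mathbb{R}^2\to\mathbb{R}$, the conformal plane $X^u$ is the Riemannian manifold $(\mathbb{R}^2, e^{2u}\cdot\delta_{Eucl})$, where $\delta_{Eucl}$ is the Euclidean Riemannian metric. Here $\Delta=\partial_x^2+\partial_y^2$ is the Euclidean Laplacian. The area of $X^u$ is $\int_{\mathbb{R}^2}e^{2u}\,d\mathcal{L}^2\in(0,\infty]$. *)

(* Defs.v *)
From HB Require Import structures.
From mathcomp Require Import all_boot all_order all_algebra.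
From mathcomp Require Import all_classical all_reals all_analysis.

Set Implicit Arguments.
Unset Strict Implicit.
Unset Printing Implicit Defensive.

Import Order.TTheory GRing.Theory Num.Theory.
Import numFieldNormedType.Exports.

Local Open Scope ring_scope.

Section ConformalPlane.
Variable R : realType.
Implicit Types u : R * R -> R.

(* ['D_v f p] has an unspecified value where the derivative does not exist;
   [C_k] guards its use with [derivable]. *)
Definition partial_x u : R * R -> R := fun p => 'D_((1 : R), (0 : R)) u p.
Definition partial_y u : R * R -> R := fun p => 'D_((0 : R), (1 : R)) u p.

(* Functions of class C^k: all iterated partial derivatives of order at most
   [k], in any order of differentiation, exist everywhere and are continuous. *)
Fixpoint C_k (k : nat) u : Prop :=
  match k with
  | 0 => continuous u
  | k'.+1 =>
      [/\ continuous u,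
          forall p, derivable u p ((1 : R), (0 : R)),
          forall p, derivable u p ((0 : R), (1 : R)),
          C_k k' (partial_x u) &
          C_k k' (partial_y u)]
  end.

Definition smooth u : Prop := forall k, C_k k u.

Definition laplacian u : R * R -> R :=
  fun p => partial_x (partial_x u) p + partial_y (partial_y u) p.

(* Two-dimensional Lebesgue measure, on the product sigma-algebra of R * R. *)
Definition lebesgue_measure2 :=
  (@lebesgue_measure R \x @lebesgue_measure R)%E.

(* The volume density of the metric e^(2u) (dx^2 + dy^2) is
   sqrt (det (e^(2u) I_2)) = e^(2u). *)
Definition conformal_area u : \bar R :=
  (\int[lebesgue_measure2]_(p in [set: R * R]) (expR (2 * u p))%:E)%E.

End ConformalPlane.

(* Main.v *)
(** Take [u (x, y) = - x^2 - k y^2] with [k >= 0]: its Laplacian is the constant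
    [- 2 - 2 k], while [e^(2u) <= 1]. The area is a product of two Gaussian
    integrals, equal to [pi / (2 sqrt k)] for [k > 0] and to [+oo] for [k = 0]. *)
Require Import Defs.
From mathcomp Require Import all_boot all_order all_algebra.
From mathcomp Require Import all_classical all_reals all_analysis.
From mathcomp Require Import measurable_realfun ring lra.
Import Order.TTheory GRing.Theory Num.Theory.
Import numFieldNormedType.Exports.

Local Open Scope ring_scope.

(* The linear terms make this family stable under [partial_x] and
   [partial_y]. *)
Definition quadratic (R : realType) (a b c d e : R) : R * R -> R :=
  fun p => a * p.1 ^+ 2 + b * p.2 ^+ 2 + c * p.1 + d * p.2 + e.

(** A continuous linear map is its own differential at every point. This yields the derivatives of
    both coordinate projections. *)
Lemma is_derive_linear (R : realType) (V W : normedModType R)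
    (f : {linear V -> W}) (p v : V) : continuous f -> is_derive p v f (f v).
Proof.
move=> cf; apply: DeriveDef; first exact/diff_derivable/linear_differentiable.
by rewrite deriveE ?diff_lin//; exact: linear_differentiable.
Qed.

Lemma is_derive_fst (R : realType) (p v : R * R) :
  is_derive p v (fst : R * R -> R) v.1.
Proof.
apply: (is_derive_linear R _ _ (fst : {linear (R * R)%type -> R})).
by move=> x; exact: cvg_fst.
Qed.

Lemma is_derive_snd (R : realType) (p v : R * R) :
  is_derive p v (snd : R * R -> R) v.2.
Proof.
apply: (is_derive_linear R _ _ (snd : {linear (R * R)%type -> R})).
by move=> x; exact: cvg_snd.
Qed.

Lemma is_derive_quadratic (R : realType) (a b c d e : R) (p v : R * R) :
  is_derive p v (quadratic R a b c d e)
    ((2 * a * p.1 + c) * v.1 + (2 * b * p.2 + d) * v.2).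
Proof.
have d1 := is_derive_fst R p v; have d2 := is_derive_snd R p v.
(* Written as an algebraic combination of functions, the polynomial is differentiated by inference
   of [is_derive] instances from [d1] and [d2]. *)
have -> : quadratic R a b c d e =
    a *: (fst : R * R -> R) ^+ 2 + b *: (snd : R * R -> R) ^+ 2
    + c *: (fst : R * R -> R) + d *: (snd : R * R -> R) + cst e by [].
apply: is_derive_eq.
rewrite !scalerA /GRing.scale /= !expr1; ring.
Qed.

Lemma partial_x_quadratic (R : realType) (a b c d e : R) :
  partial_x (quadratic R a b c d e) = quadratic R 0 0 (2 * a) 0 c.
Proof.
apply/funext => p; rewrite /partial_x.
have -> := derive_val (is_derive := is_derive_quadratic R a b c d e p (1, 0)).
by rewrite /quadratic /=; ring.
Qed.

Lemma partial_y_quadratic (R : realType) (a b c d e : R) :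
  partial_y (quadratic R a b c d e) = quadratic R 0 0 0 (2 * b) d.
Proof.
apply/funext => p; rewrite /partial_y.
have -> := derive_val (is_derive := is_derive_quadratic R a b c d e p (0, 1)).
by rewrite /quadratic /=; ring.
Qed.

Lemma continuous_quadratic (R : realType) (a b c d e : R) :
  continuous (quadratic R a b c d e).
Proof.
move=> p; rewrite /continuous_at /quadratic.
have c1 : (fst @ p --> p.1)%classic by exact: cvg_fst.
have c2 : (snd @ p --> p.2)%classic by exact: cvg_snd.
rewrite !expr2; under eq_fun do rewrite !expr2.
by do !apply: cvgD; do ?[exact: cvg_cst | apply: cvgM].
Qed.

(** Induction on the order [k], for all coefficients at once, since each partial derivative stays in
    the family but changes them. *)
Lemma smooth_quadratic (R : realType) (a b c d e : R) :
  smooth (quadratic R a b c d e).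
Proof.
move=> k; elim: k a b c d e => [|k IH] a b c d e /=.
  exact: continuous_quadratic.
split; rewrite ?partial_x_quadratic ?partial_y_quadratic //.
- exact: continuous_quadratic.
- by move=> p; have [] := is_derive_quadratic R a b c d e p (1, 0).
- by move=> p; have [] := is_derive_quadratic R a b c d e p (0, 1).
Qed.

Lemma laplacian_quadratic (R : realType) (a b c d e : R) (p : R * R) :
  laplacian (quadratic R a b c d e) p = 2 * a + 2 * b.
Proof.
rewrite /laplacian !(partial_x_quadratic, partial_y_quadratic).
by rewrite /quadratic; ring.
Qed.

Lemma measurable_expR_sqr (R : realType) (a : R) :
  measurable_fun [set: R] (fun x : R => expR (- (a * x ^+ 2))).
Proof.
apply: measurableT_comp => //; apply: measurableT_comp => //.
by apply: measurable_funM => //; exact: measurable_funX.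
Qed.

(** The integrand is [Num.sqrt (pi / a)] times the centred normal density of variance [1 / (2 * a)],
    whose total mass is 1. *)
Lemma integral_expR_sqr (R : realType) (a : R) : 0 < a ->
  (\int[@lebesgue_measure R]_x (expR (- (a * x ^+ 2)))%:E
   = (Num.sqrt (pi / a))%:E)%E.
Proof.
move=> a0; pose s := Num.sqrt ((2 * a)^-1).
have s2 : s ^+ 2 = (2 * a)^-1 by rewrite sqr_sqrtr// invr_ge0; lra.
have s0 : s != 0 by rewrite gt_eqF// sqrtr_gt0 invr_gt0; lra.
(* The left side is the radicand in [normal_peak], so the factor [Num.sqrt (pi / a)] cancels the
   peak. *)
have piE : s ^+ 2 * pi *+ 2 = pi / a.
  by rewrite s2 -mulr_natl; field; rewrite gt_eqF.
have pa0 : 0 < pi / a :> R by rewrite divr_gt0 ?pi_gt0.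
transitivity (\int[@lebesgue_measure R]_x
    ((Num.sqrt (pi / a))%:E * (normal_pdf 0 s x)%:E))%E.
  apply: eq_integral => x _; rewrite normal_pdfE// -EFinM; congr EFin.
  rewrite /normal_peak piE mulVKf ?gt_eqF ?sqrtr_gt0// /normal_fun.
  by rewrite s2 subr0; congr expR; rewrite -mulr_natl; field; rewrite gt_eqF.
rewrite ge0_integralZl//.
- by rewrite integral_normal_pdf// mule1.
- by apply/measurable_EFinP; exact: measurable_normal_pdf.
- by move=> x _; rewrite lee_fin normal_pdf_ge0.
Qed.

(** Without mixed or linear terms the density splits into a function of [x] times a function of [y],
    and Tonelli's theorem applies. *)
Lemma conformal_area_quadratic (R : realType) (a b : R) :
  conformal_area (quadratic R (- a) (- b) 0 0 0) =
  (\int[@lebesgue_measure R]_x (expR (- (2 * a * x ^+ 2)))%:E *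
   \int[@lebesgue_measure R]_y (expR (- (2 * b * y ^+ 2)))%:E)%E.
Proof.
rewrite /conformal_area /lebesgue_measure2.
transitivity (\int[(@lebesgue_measure R \x @lebesgue_measure R)%E]_p
    ((expR (- (2 * a * p.1 ^+ 2)))%:E * (expR (- (2 * b * p.2 ^+ 2)))%:E))%E.
  apply: eq_integral => p _; rewrite -EFinM -expRD; congr (expR _)%:E.
  by rewrite /quadratic; ring.
rewrite fubini_tonelli1; last 2 first.
- apply: emeasurable_funM; apply/measurable_EFinP.
    exact: (measurableT_comp (measurable_expR_sqr R (2 * a))).
  exact: (measurableT_comp (measurable_expR_sqr R (2 * b))).
- by move=> p; rewrite mule_ge0 ?lee_fin ?expR_ge0.
(* The [y]-integral is a nonnegative constant, so it moves under the [x]-integral; the integrands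
   are then compared for each [x]. *)
rewrite -[RHS]ge0_integralZr//; first last.
- by apply: integral_ge0 => y _; rewrite lee_fin expR_ge0.
- by apply/measurable_EFinP; exact: measurable_expR_sqr.
apply: eq_integral => x _; rewrite /fubini_F /= ge0_integralZl//.
- by apply/measurable_EFinP; exact: measurable_expR_sqr.
Qed.

Lemma quadratic_curvature (R : realType) (k : R) (p : R * R) : 0 <= k ->
  laplacian (quadratic R (- 1) (- k) 0 0 0) p
    + expR (2 * quadratic R (- 1) (- k) 0 0 0 p) <= 0.
Proof.
move=> k0; rewrite laplacian_quadratic.
(* The Laplacian is [- 2 - 2 * k], at most [- 2], which leaves room for an exponential of a
   nonpositive number. *)
suff : expR (2 * quadratic R (- 1) (- k) 0 0 0 p) <= 1 by lra.
rewrite -[leRHS]expR0 ler_expR /quadratic.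
rewrite (_ : 2 * _ = - (2 * (p.1 ^+ 2 + k * p.2 ^+ 2))); last by ring.
by rewrite oppr_le0 mulr_ge0// addr_ge0 ?sqr_ge0// mulr_ge0// sqr_ge0.
Qed.

Theorem proposition1p2 (R : realType) (A : \bar R) (hA : (0 < A)%E) :
  exists u : R * R -> R,
    [/\ smooth u,
        forall p : R * R, laplacian u p + expR (2 * u p) <= 0 &
        conformal_area u = A].
Proof.
have pi0 := pi_gt0 R.
have [k k0 areaE] : exists2 k : R, 0 <= k &
    conformal_area (quadratic R (- 1) (- k) 0 0 0) = A.
  case: A hA => [A| |] //; rewrite ?lte_fin => A0.
    (* This [k] solves [pi / (2 * Num.sqrt k) = A]. *)
    exists ((pi / (2 * A)) ^+ 2); first exact: sqr_ge0.
    have q0 : 0 < pi / (2 * A) :> R by rewrite divr_gt0//; lra.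
    rewrite conformal_area_quadratic !integral_expR_sqr; [|nra|lra].
    rewrite -EFinM -sqrtrM; last by rewrite divr_ge0//; lra.
    (* With [A] written as the root of its square, only an equality of radicands remains, a rational
       identity in [pi] and [A]. *)
    congr EFin; rewrite -[RHS]gtr0_norm// -sqrtr_sqr; congr Num.sqrt.
    by move: (@pi R) pi0 {q0} => q q0; field; rewrite !gt_eqF.
  (* For infinite area, [k = 0] makes the [y]-integrand constantly 1; its integral is the length of
     the whole line, and the [x]-factor is positive. *)
  exists 0 => //; rewrite conformal_area_quadratic integral_expR_sqr; last lra.
  under [X in (_ * X)%E]eq_integral do rewrite mulr0 mul0r oppr0 expR0.
  rewrite integral_cst//= -set_itvNyy lebesgue_measure_itv/=.
  by rewrite mul1e gt0_muley// lte_fin sqrtr_gt0 divr_gt0//; lra.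
exists (quadratic R (- 1) (- k) 0 0 0); split => //.
  exact: smooth_quadratic.
by move=> p; exact: quadratic_curvature.
Qed.
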